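(* Let $1/4<\theta\le 1$ be a fixed real number. Suppose $A_1$ and $A_2$ are two $\theta$-short almost dense sets of positive integers, with associated functions $F_{A_1}$ and $F_{A_2}$. Then there exist constants $C>0$, $K>0$ and $x_0\ge 10$ such that for every real $x\ge x_0$, putting $$y(\theta)=C\,\frac{x^{5/6-\theta/3}(\log x)^{3/2}}{F_{A_1}(x^{1/3})F_{A_2}(x^{1/3})},$$ the interval $(x,x+y(\theta)]$ contains at least one $\theta$-short almost cube $n=a_1a_2m$ (with $m$ a positive integer) such that $$a_j\in A_j,\quad |a_j-n^{1/3}|\le K n^{\theta/3}\ (j=1,2),\qquad |m-n^{1/3}|\le K n^{\theta/3}.$$
   Context: Definition ($\theta$-short almost dense). Let $0<\theta\le 1$ be fixed and let $A$ be an infinite set of positive integers. $A$ is called $\theta$-short almost dense if there is a function $F_A:[1,\infty)\to(0,\infty)$ with $X^{-\varepsilon}\ll_\varepsilon F_A(X)\ll_\varepsilon X^{\varepsilon}$ as $X\to\infty$ for every $\varepsilon>0$, such that $$\sum_{X<n\le X+X',\ n\in A}1\ \ge\ F_A(X)\,X'$$ for all sufficiently large $X$ and all $X'$ with $X^{\theta}\ll X'\ll X$ (that is: for any fixed constants $0<c_1<c_2$, the inequality holds for all $X$ sufficiently large in terms of $c_1,c_2$ and all $X'$ with $c_1X^\theta\le X'\le c_2X$). Definition ($\theta$-short almost cube). A positive integer $n$ is a $\theta$-short almost cube if $n=n_1n_2n_3$ with positive integers $n_j$ satisfying $|n_j-n^{1/3}|\le C_j n^{\theta/3}$ ($j=1,2,3$)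 for positive constants $C_j$ (independent of $n$ and $x$). *)

(* Defs.v *)
From mathcomp Require Import all_boot all_order all_algebra.
From mathcomp Require Import all_classical all_reals all_analysis.

Set Implicit Arguments.
Unset Strict Implicit.
Unset Printing Implicit Defensive.

Import Order.TTheory GRing.Theory Num.Theory.
Import numFieldNormedType.Exports.

Local Open Scope classical_set_scope.
Local Open Scope ring_scope.

(* [A] is theta-short almost dense with associated function [F]. [F] stands
   for a function [1, +oo) -> (0, +oo): its values below 1 are never used. In
   the last clause [c1 X^theta <= X' <= c2 X] spells out
   [X^theta << X' << X]; "sufficiently large" may depend on [c1] and [c2]. *)
Definition short_almost_dense (R : realType) (theta : R) (A : set nat)
    (F : R -> R) : Prop :=
  [/\ infinite_set A,
      (forall n, A n -> (0 < n)%N),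
      (forall X, 1 <= X -> 0 < F X),
      (forall eps : R, 0 < eps ->
         exists c : R, [/\ 0 < c,
           \forall X \near +oo%R, X `^ (- eps) <= c * F X &
           \forall X \near +oo%R, F X <= c * X `^ eps]) &
      forall c1 c2 : R, 0 < c1 -> c1 < c2 ->
        \forall X \near +oo%R, forall X' : R,
          c1 * X `^ theta <= X' -> X' <= c2 * X ->
          F X * X' <=
            \sum_(n \in [set n | A n /\ X < n%:R <= X + X']) (1 : R)].

Definition close_to_cbrt (R : realType) (theta C : R) (n k : nat) : Prop :=
  `|k%:R - n%:R `^ (1 / 3)| <= C * n%:R `^ (theta / 3).

(* The constants are arguments: quantified existentially for each [n]
   separately, they would make every positive [n] an almost cube. *)
Definition short_almost_cube (R : realType) (theta C1 C2 C3 : R) (n : nat)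
    : Prop :=
  [/\ 0 < C1, 0 < C2 & 0 < C3] /\
  exists n1 n2 n3 : nat,
    [/\ [/\ (0 < n1)%N, (0 < n2)%N & (0 < n3)%N],
        n = (n1 * n2 * n3)%N,
        close_to_cbrt theta C1 n n1,
        close_to_cbrt theta C2 n n2 &
        close_to_cbrt theta C3 n n3].

Definition interval_length (R : realType) (theta C : R) (F1 F2 : R -> R)
    (x : R) : R :=
  C * (x `^ (5 / 6 - theta / 3) * ln x `^ (3 / 2)
       / (F1 (x `^ (1 / 3)) * F2 (x `^ (1 / 3)))).

(* Main.v *)
Require Import Defs.
From mathcomp Require Import all_boot all_order all_algebra.
From mathcomp Require Import all_classical all_reals all_analysis.
From mathcomp Require Import zify ring lra.
From mathcomp Require cyclic.

Set Implicit Arguments.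
Unset Strict Implicit.
Unset Printing Implicit Defensive.

Import Order.TTheory GRing.Theory Num.Theory.
Import numFieldNormedType.Exports.

Local Open Scope classical_set_scope.
Local Open Scope ring_scope.

(* Put [X = x^(1/3)] and [H = X^theta], and let [U], [V] be the parts of [A1],
   [A2] in [(X, X + H]]; the task is to find [a * b * m] in [(x, x + y]] with [a]
   in [U] and [b] in [V].  If [y >= 4 X^2], any [a] and [b] will do.  Otherwise let
   [h] be about [y / (32 X)].  If there is no such product, then for every [b] in
   [V] each of the [h] integers [n] following [x / b] is such that no [a] in [U]
   has a multiple in [(n, n + h]].  These are [h |V|] distinct integers in
   [[0, Q^2]], [Q = floor (2 X)], at which the sum over [a] in [U] of the
   discrepancies [#{multiples of a in (n, n + h]} - h / a] is at most
   [- h |U| / (2 X)].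

   This contradicts a large sieve bound for the mean square of that sum.  With
   [K = Q!] and [P = 8 Q^2 K], the Fejer kernel [|sum_(k < K) e(kn/P)|^2] is at
   least [K^2 / 2] on [[0, Q^2]], and its sum against a [D]-periodic function over
   a period [P] sees only the mean of that function as soon as [K D <= P].  This
   applies to the products of two discrepancies, [D] being the lcm of [a] and [a'],
   and reduces the mean square to the correlations over a full period, which are at
   most [h gcd(a, a') / (a a')].  Finally [gcd = sum of totients] bounds the sum of
   the gcds over [U^2] by [O(X H log x)]. *)

(** * Sums over a full period and the Fejer kernel *)

Lemma sum_shift_periodic (V : nmodType) (F : nat -> V) (P D : nat) :
  (forall n, F (n + P)%N = F n) ->
  \sum_(n < P) F (n + D)%N = \sum_(n < P) F n.
Proof.
have step (f : nat -> V) : (forall n, f (n + P)%N = f n) ->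
    \sum_(n < P) f n.+1 = \sum_(n < P) f n.
  case: P => [|p] fP; first by rewrite !big_ord0.
  by rewrite big_ord_recr big_ord_recl /= addrC -(fP 0%N).
move=> FP; elim: D => [|D IHD]; first by under eq_bigr do rewrite addn0.
rewrite -IHD -(step (fun n => F (n + D)%N)) => [|n]; last by rewrite addnAC FP.
by apply: eq_bigr => n _; rewrite addnS addSn.
Qed.

Lemma ler_cos (R : realType) :
  {in `[0, pi] &, {mono @cos R : x y /~ y <= x}}.
Proof. by move=> x y xI yI; rewrite !leNgt ltr_cos. Qed.

Section Fejer.
Variable R : realType.
Implicit Types (G : nat -> R) (P D K j k l n : nat).

Definition angle P k n : R := 2 * pi * k%:R * n%:R / P%:R.

Lemma cos_angleDP P k n : (0 < P)%N -> cos (angle P k (n + P)) = cos (angle P k n).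
Proof.
move=> P0; rewrite -[RHS](periodicn (@cosD2pi R) k); congr cos.
by rewrite /angle natrD; field; rewrite pnatr_eq0 -lt0n.
Qed.

Lemma sin_angleDP P k n : (0 < P)%N -> sin (angle P k (n + P)) = sin (angle P k n).
Proof.
move=> P0; rewrite -[RHS](periodicn (@sinD2pi R) k); congr sin.
by rewrite /angle natrD; field; rewrite pnatr_eq0 -lt0n.
Qed.

Lemma periodic_dvdn G P D n :
  (forall m, G (m + D)%N = G m) -> (D %| P)%N -> G (n + P)%N = G n.
Proof.
move=> GD /dvdnP[q ->]; elim: q n => [|q IHq] n; first by rewrite addn0.
by rewrite mulSn addnA IHq GD.
Qed.

(* Shifting [n] by [D] multiplies the sum of [e(jn/P) G(n)] by [e(jD/P)], which
   differs from [1]. *)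
Lemma sum_cos_periodic G P D j :
  (forall n, G (n + D)%N = G n) -> (D %| P)%N -> (0 < j)%N -> (j * D < P)%N ->
  \sum_(n < P) cos (angle P j n) * G n = 0.
Proof.
move=> GD DP j0 jDP.
have P0 : (0 < P)%N by apply: leq_ltn_trans jDP.
have D0 : (0 < D)%N by case: D DP {GD jDP} => //; rewrite dvd0n => /eqP PE; rewrite PE in P0.
set C := \sum_(n < P) _; pose S := \sum_(n < P) sin (angle P j n) * G n.
set c := cos (angle P j D); set s := sin (angle P j D).
have GP n : G (n + P)%N = G n by exact: periodic_dvdn GD DP.
have fD n : angle P j (n + D) = angle P j n + angle P j D.
  by rewrite /angle natrD; ring.
have CE : C = C * c - S * s.
  rewrite {1}/C -(sum_shift_periodic (F := fun n => cos (angle P j n) * G n) D); last first.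
    by move=> n; rewrite cos_angleDP // GP.
  rewrite mulr_suml [S * s]mulr_suml -sumrB; apply: eq_bigr => n _.
  by rewrite fD cosD GD /c /s; ring.
have SE : S = S * c + C * s.
  rewrite {1}/S -(sum_shift_periodic (F := fun n => sin (angle P j n) * G n) D); last first.
    by move=> n; rewrite sin_angleDP // GP.
  rewrite mulr_suml [C * s]mulr_suml -big_split; apply: eq_bigr => n _ /=.
  by rewrite fD sinD GD /c /s; ring.
(* The angle is [2 t] with [0 < t < pi], because [0 < j * D < P], so its cosine [1 - 2 sin^2 t] is
   below 1. *)
have c1 : c < 1.
  pose t : R := pi * (j * D)%:R / P%:R.
  have tE : angle P j D = t *+ 2.
    by rewrite /angle /t natrM; ring.
  have st : 0 < sin t.
    have PR : 0 < P%:R :> R by rewrite ltr0n.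
    apply: sin_gt0_pi; rewrite /t; apply/andP; split.
      by rewrite divr_gt0 // mulr_gt0 ?pi_gt0 // ltr0n muln_gt0 j0.
    by rewrite ltr_pdivrMr // ltr_pM2l ?pi_gt0 // ltr_nat.
  have := cos2Dsin2 t; rewrite /c tE cos_mulr2n.
  by move: st; move: (cos t) (sin t) => u v v0 uv; nra.
(* The rotation by [(c, s)] fixes the pair [(C, S)]; eliminating [S] leaves a factor that is
   positive because [c < 1]. *)
have /eqP : ((1 - c) ^+ 2 + s ^+ 2) * C = 0.
  have -> : ((1 - c) ^+ 2 + s ^+ 2) * C = (1 - c) * (C - (C * c - S * s)) -
    s * (S - (S * c + C * s)) by ring.
  by rewrite -CE -SE !subrr !mulr0 subr0.
rewrite mulf_eq0 => /orP[|/eqP //].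
by rewrite paddr_eq0 ?sqr_ge0 // sqrf_eq0 subr_eq0 eq_sym (lt_eqF c1).
Qed.

(** The squared modulus of the sum of [e(kn/P)] over [k < K], without the usual factor [1 / K],
    split into real and imaginary parts to stay in [R]. *)
Definition fejer K P n : R :=
  (\sum_(k < K) cos (angle P k n)) ^+ 2 + (\sum_(k < K) sin (angle P k n)) ^+ 2.

Lemma fejer_ge0 K P n : 0 <= fejer K P n.
Proof. by rewrite addr_ge0 ?sqr_ge0. Qed.

Lemma fejerE K P n :
  fejer K P n = \sum_(k < K) \sum_(l < K) cos (angle P k n - angle P l n).
Proof.
rewrite /fejer !expr2 !mulr_suml -big_split; apply: eq_bigr => k _ /=.
by rewrite !mulr_sumr -big_split; apply: eq_bigr => l _ /=; rewrite cosB.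
Qed.

(** In the double sum over [k], [l], an off-diagonal term has frequency [j = |k - l|] with
    [0 < j < K], hence [j * D < P], and [sum_cos_periodic] kills it. Each of the [K] diagonal terms
    contributes the plain sum of [G]. *)
Lemma sum_fejer_periodic G P D K :
  (forall n, G (n + D)%N = G n) -> (D %| P)%N -> (0 < P)%N -> (K * D <= P)%N ->
  \sum_(n < P) fejer K P n * G n = K%:R * \sum_(n < P) G n.
Proof.
move=> GD DP P0 KD.
have D0 : (0 < D)%N by exact: dvdn_gt0 DP.
have offdiag k l : (k < K)%N -> (l < k)%N ->
    \sum_(n < P) cos (angle P k n - angle P l n) * G n = 0.
  move=> kK lk; transitivity (\sum_(n < P) cos (angle P (k - l) n) * G n).
    apply: eq_bigr => n _; congr (cos _ * _).
    by rewrite /angle natrB 1?ltnW //; ring.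
  apply: (sum_cos_periodic GD DP); rewrite ?subn_gt0 //.
  by apply: leq_trans KD; rewrite ltn_pmul2r //; lia.
under eq_bigr do rewrite fejerE mulr_suml.
rewrite exchange_big /=.
transitivity (\sum_(k < K) \sum_(n < P) G n); last first.
  by rewrite sumr_const card_ord mulr_natl.
apply: eq_bigr => k _.
under eq_bigr do rewrite mulr_suml.
rewrite exchange_big /= (bigD1 k) //= [X in _ + X]big1 => [|l lk].
  rewrite addr0; apply: eq_bigr => n _; by rewrite subrr cos0 mul1r.
have [kl|kl|/val_inj kl] := ltngtP k l.
- rewrite -[RHS](offdiag l k) //; apply: eq_bigr => n _.
  by rewrite -cosN opprB.
- exact: offdiag.
- by rewrite kl eqxx in lk.
Qed.

(** All the angles lie in [[0, pi / 4]], so every cosine is at least [cos (pi / 4)], whose square is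
    [1 / 2]; the sine part is dropped. *)
Lemma fejer_lb K P n :
  (0 < P)%N -> (8 * K * n <= P)%N -> K%:R ^+ 2 / 2 <= fejer K P n.
Proof.
rewrite -(ltr0n R) => P0.
case: K => [|K] KP; first by rewrite expr0n mul0r fejer_ge0.
pose c : R := cos (pi / 4).
have pi0 : 0 < pi :> R := pi_gt0 R.
have c0 : 0 <= c by apply: cos_ge0_pihalf; apply/andP; split; lra.
have c2 : 1 / 2 <= c ^+ 2.
  have := @cos_pihalf R; have -> : pi / 2 = pi / 4 *+ 2 :> R by rewrite [RHS]mulr2n; lra.
  by rewrite cos_mulr2n -/c; lra.
have lb (k : 'I_K.+1) : c <= cos (angle P k n).
  have f0 : 0 <= angle P k n.
    by rewrite /angle divr_ge0 ?ler0n // !mulr_ge0 ?ler0n // pi_ge0.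
  have f4 : angle P k n <= pi / 4.
    rewrite /angle ler_pdivrMr //.
    have : (8 * k * n)%:R <= P%:R :> R.
      by rewrite ler_nat (leq_trans _ KP) // leq_mul2r leq_mul2l /= ltnW ?ltn_ord ?orbT.
    rewrite !natrM => /(ler_wpM2l (pi_ge0 R)).
    by lra.
  by rewrite /c ler_cos // in_itv /=; apply/andP; split; lra.
have : K.+1%:R * c <= \sum_(k < K.+1) cos (angle P k n).
  rewrite mulr_natl -{1}(card_ord K.+1) -sumr_const.
  exact: ler_sum.
rewrite /fejer; set A := \sum_(k < K.+1) _; set B := \sum_(k < K.+1) _ => cA.
have : (K.+1%:R * c) ^+ 2 <= A ^+ 2.
  by rewrite ler_pXn2r // nnegrE ?mulr_ge0 ?ler0n // (le_trans _ cA) ?mulr_ge0 ?ler0n.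
rewrite exprMn; have := sqr_ge0 B.
have := ler_wpM2l (sqr_ge0 (K.+1%:R : R)) c2.
by lra.
Qed.

End Fejer.

(** * Multiples in blocks of length [h]: correlations and the large sieve *)

(** Members of one residue class modulo [D] are told apart by their quotients, which are below
    [q]. *)
Lemma size_modn_class (s : seq nat) (D q : nat) :
  uniq s -> {in s, forall n, n < D * q}%N ->
  {in s &, forall m n, m = n %[mod D]} -> (size s <= q)%N.
Proof.
move=> us sDq smod; rewrite -(size_map (divn^~ D)) -(size_iota 0 q).
apply: uniq_leq_size => [|k /mapP[n ns ->]]; last first.
  rewrite mem_iota leq0n /= add0n ltn_divLR 1?mulnC ?sDq //.
  by case: D sDq {smod} => [/(_ _ ns)|//]; rewrite mul0n.
rewrite map_inj_in_uniq // => m n ms ns mn.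
by rewrite (divn_eq m D) (divn_eq n D) mn (smod m n).
Qed.

Lemma sum_nat_count (p : pred nat) n :
  (\sum_(i < n) p i)%N = size [seq i <- iota 0 n | p i].
Proof.
rewrite size_filter -sum1_count [RHS]big_mkcond.
rewrite -(big_mkord xpredT (fun i => p i : nat)) /index_iota subn0.
by apply: eq_bigr => i _; case: (p i).
Qed.

Section Hits.
Variable R : realType.
Implicit Types a b h i j n P : nat.

Definition hits h a n : nat := \sum_(i < h) (a %| n + i.+1)%N.

Definition discrepancy h a n : R := (hits h a n)%:R - h%:R / a%:R.

Lemma hits_eq0 h a n :
  (forall i, (i < h)%N -> ~~ (a %| n + i.+1)%N) -> hits h a n = 0%N.
Proof. by move=> H; apply: big1 => i _; rewrite (negbTE (H i _)). Qed.

Lemma discrepancy_periodic h a D n :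
  (a %| D)%N -> discrepancy h a (n + D) = discrepancy h a n.
Proof.
move=> aD; congr (_%:R - _); apply: eq_bigr => i _.
by rewrite addnAC dvdn_addl.
Qed.

Lemma sum_dvdn a P i : (0 < a)%N -> (a %| P)%N ->
  \sum_(n < P) (a %| n + i)%N%:R = P%:R / a%:R :> R.
Proof.
move=> a0 aP; have per n : (a %| n + P)%N%:R = (a %| n)%N%:R :> R by rewrite dvdn_addl.
rewrite (sum_shift_periodic (F := fun n => (a %| n)%N%:R : R)) //.
(* Moving the range to [[1, P]] turns the sum into the count of positive multiples of [a] up to
   [P]. *)
rewrite -(sum_shift_periodic (F := fun n => (a %| n)%N%:R : R) 1) //.
have -> : P%:R / a%:R = (P %/ a)%:R :> R.
  by case/dvdnP: aP => q ->; rewrite mulnK // natrM mulfK // pnatr_eq0 -lt0n.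
rewrite divn_count_dvd natr_sum big_add1 big_mkord.
by apply: eq_bigr => n _; rewrite addn1.
Qed.

Lemma sum_hits h a P : (0 < a)%N -> (a %| P)%N ->
  \sum_(n < P) (hits h a n)%:R = P%:R * (h%:R / a%:R) :> R.
Proof.
move=> a0 aP; under eq_bigr do rewrite natr_sum.
rewrite exchange_big /=; under eq_bigr do rewrite sum_dvdn //.
by rewrite sumr_const card_ord -mulr_natr; ring.
Qed.

(** The two divisibilities force [i = j] modulo the gcd and then leave one class of [n] modulo the
    lcm, where [1 / lcm = gcd / (a b)]. *)
Lemma sum_dvdn2_le a b P i j : (0 < a)%N -> (0 < b)%N -> (lcmn a b %| P)%N ->
  \sum_(n < P) ((a %| n + i)%N && (b %| n + j)%N)%:R <=
    (i == j %[mod gcdn a b])%N%:R * (P%:R * (gcdn a b)%:R / (a%:R * b%:R)) :> R.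
Proof.
move=> a0 b0 abP; set d := gcdn a b.
rewrite -natr_sum (sum_nat_count (fun n => (a %| n + i) && (b %| n + j))%N).
set s := [seq _ <- _ | _].
have sP n : n \in s -> [/\ (n < P)%N, (a %| n + i)%N & (b %| n + j)%N].
  by rewrite mem_filter mem_iota /= add0n => /andP[/andP[]].
have [ij|ij] := boolP (i == j %[mod d])%N; last first.
  rewrite mul0r lern0 size_eq0; apply/eqP; case E : s => [//|n s'].
  have [_ an bn] : [/\ (n < P)%N, (a %| n + i)%N & (b %| n + j)%N].
    by apply: sP; rewrite E mem_head.
  case/negP: ij; rewrite -(eqn_modDl n) /d.
  have da : (gcdn a b %| n + i)%N := dvdn_trans (dvdn_gcdl a b) an.
  have db : (gcdn a b %| n + j)%N := dvdn_trans (dvdn_gcdr a b) bn.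
  by rewrite (eqP da) (eqP db).
rewrite mul1r.
have -> : P%:R * d%:R / (a%:R * b%:R) = (P %/ lcmn a b)%:R :> R.
  case/dvdnP: abP => q ->; rewrite mulnK ?lcmn_gt0 ?a0 //.
  by rewrite -!natrM -mulnA muln_lcm_gcd natrM mulfK // pnatr_eq0 -lt0n muln_gt0 a0.
rewrite ler_nat; apply: (@size_modn_class _ (lcmn a b)).
- by rewrite filter_uniq // iota_uniq.
- by move=> n /sP[]; rewrite mulnC divnK.
- move=> m n.
  wlog mn : m n / (m <= n)%N.
    by move=> H ms ns; case/orP: (leq_total m n) => le; [|symmetry]; apply: H.
  move=> /sP[_ am bm] /sP[_ an bn]; apply/esym/eqP; rewrite eqn_mod_dvd //.
  by rewrite dvdn_lcm -{1}(subnDr i n m) -{1}(subnDr j n m) !dvdn_sub.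
Qed.

(** For each offset [i] at most [h / d + 1] offsets [j] are congruent to it modulo [d = gcdn a b],
    and each such pair costs at most [P d / (a b)]. *)
Lemma sum_hits2_le h a b P : (0 < a)%N -> (0 < b)%N -> (lcmn a b %| P)%N ->
  \sum_(n < P) (hits h a n)%:R * (hits h b n)%:R <=
    P%:R * (h%:R ^+ 2 / (a%:R * b%:R) + h%:R * (gcdn a b)%:R / (a%:R * b%:R)) :> R.
Proof.
move=> a0 b0 abP; set d := gcdn a b.
have d0 : (0 < d)%N by rewrite gcdn_gt0 a0.
have dR : 0 < d%:R :> R by rewrite ltr0n.
pose c : R := P%:R * d%:R / (a%:R * b%:R).
have c0 : 0 <= c by rewrite divr_ge0 ?mulr_ge0 ?ler0n.
have cnt (i : 'I_h) : \sum_(j < h) (i.+1 == j.+1 %[mod d])%N%:R <= h%:R / d%:R + 1 :> R.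
  rewrite -natr_sum (sum_nat_count (fun j => i.+1 == j.+1 %[mod d])%N).
  apply: (@le_trans _ _ (h %/ d).+1%:R); last first.
    by rewrite -natr1 lerD2r ler_pdivlMr // -natrM ler_nat leq_trunc_div.
  rewrite ler_nat; apply: (@size_modn_class _ d).
  - by rewrite filter_uniq // iota_uniq.
  - move=> n; rewrite mem_filter mem_iota /= => /andP[_ nh].
    by rewrite mulnC; apply: leq_trans nh _; rewrite ltnW // ltn_ceil.
  - move=> m n; rewrite !mem_filter => /andP[/eqP im _] /andP[/eqP jn _].
    by apply/eqP; rewrite -(eqn_modDr 1) !addn1 -im -jn.
have -> : \sum_(n < P) (hits h a n)%:R * (hits h b n)%:R =
    \sum_(i < h) \sum_(j < h) \sum_(n < P) ((a %| n + i.+1)%N && (b %| n + j.+1)%N)%:R :> R.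
  under eq_bigr do rewrite /hits !natr_sum big_distrlr.
  rewrite exchange_big; apply: eq_bigr => i _ /=.
  rewrite exchange_big; apply: eq_bigr => j _ /=.
  by apply: eq_bigr => n _; rewrite -natrM mulnb.
apply: (@le_trans _ _ (\sum_(i < h) (h%:R / d%:R + 1) * c)).
  apply: ler_sum => i _.
  apply: (@le_trans _ _ (\sum_(j < h) (i.+1 == j.+1 %[mod d])%N%:R * c)).
    by apply: ler_sum => j _; apply: sum_dvdn2_le.
  by rewrite -mulr_suml ler_wpM2r.
rewrite sumr_const card_ord -[leLHS]mulr_natr /c.
suff -> : (h%:R / d%:R + 1) * (P%:R * d%:R / (a%:R * b%:R)) * h%:R = P%:R *
  (h%:R ^+ 2 / (a%:R * b%:R) + h%:R * d%:R / (a%:R * b%:R)) :> R by [].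
by field; rewrite !pnatr_eq0 -!lt0n d0 a0 b0.
Qed.

(** After expansion, the two cross terms and the constant term together contribute
    [- P (h / a) (h / b)], which cancels the main term of [sum_hits2_le]; only the gcd term
    survives. *)
Lemma sum_discrepancy2_le h a b P :
  (0 < a)%N -> (0 < b)%N -> (lcmn a b %| P)%N ->
  \sum_(n < P) discrepancy h a n * discrepancy h b n <=
    P%:R * (h%:R * (gcdn a b)%:R / (a%:R * b%:R)).
Proof.
move=> a0 b0 abP.
have aP : (a %| P)%N := dvdn_trans (dvdn_lcml a b) abP.
have bP : (b %| P)%N := dvdn_trans (dvdn_lcmr a b) abP.
have := sum_hits2_le h a0 b0 abP.
have -> : \sum_(n < P) discrepancy h a n * discrepancy h b n =
   \sum_(n < P) (hits h a n)%:R * (hits h b n)%:R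
   - (\sum_(n < P) (hits h a n)%:R) * (h%:R / b%:R)
   - (\sum_(n < P) (hits h b n)%:R) * (h%:R / a%:R)
   + \sum_(n < P) (h%:R / a%:R) * (h%:R / b%:R).
  rewrite !mulr_suml -!sumrB -big_split; apply: eq_bigr => n _ /=.
  by rewrite /discrepancy; ring.
rewrite !sum_hits // sumr_const card_ord -mulr_natr mulrDr.
have -> : h%:R ^+ 2 / (a%:R * b%:R) = (h%:R / a%:R) * (h%:R / b%:R) :> R.
  by rewrite invfM; ring.
by move: (_ / a%:R) (_ / b%:R) => u v; lra.
Qed.

(** The Fejer-weighted mean square of the summed discrepancies is at least the share of [bs], where
    every discrepancy is [- h / a]; by periodicity it is at most [K] times the correlations over a
    full period. *)
Lemma large_sieve (Q h : nat) (us bs : seq nat) :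
  {in us, forall a, 0 < a <= Q}%N -> uniq bs -> {in bs, forall n, n <= Q ^ 2}%N ->
  (forall n a i, n \in bs -> a \in us -> (i < h)%N -> ~~ (a %| n + i.+1)%N) ->
  (size bs)%:R * (\sum_(a <- us) h%:R / a%:R) ^+ 2 <=
    16 * Q%:R ^+ 2 *
    \sum_(a <- us) \sum_(b <- us) h%:R * (gcdn a b)%:R / (a%:R * b%:R) :> R.
Proof.
move=> usQ ubs bsQ nohit.
case: bs => [|n0 bs0] in ubs bsQ nohit *.
  rewrite mul0r mulr_ge0 ?mulr_ge0 ?exprn_ge0 ?ler0n // sumr_ge0 // => a _.
  by rewrite sumr_ge0 // => b _; rewrite divr_ge0 ?mulr_ge0 ?ler0n.
set bs := n0 :: bs0 in ubs bsQ nohit *.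
have [->|us0] := eqVneq us [::]; first by rewrite !big_nil expr0n !mulr0.
have Q0 : (0 < Q)%N.
  by case: us us0 usQ {nohit} => // a us _ /(_ a (mem_head _ _)) /andP[]; apply: leq_trans.
(* [K] is a multiple of every lcm of two elements of [us], and so is [P]. The factor [8 * Q ^ 2]
   yields both [8 * K * n <= P] for [n <= Q ^ 2] and [K * D <= P] for every such lcm
   [D <= Q ^ 2]. *)
set K := Q`!; pose P := (8 * Q ^ 2 * K)%N.
have K0 : (0 < K)%N by exact: fact_gt0.
have P0 : (0 < P)%N by rewrite !muln_gt0 K0 Q0.
have KR : 0 < K%:R :> R by rewrite ltr0n.
have lcmK a b : a \in us -> b \in us -> (lcmn a b %| K)%N.
  by move=> /usQ aQ /usQ bQ; rewrite dvdn_lcm !dvdn_fact.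
have lcmP a b : a \in us -> b \in us -> (lcmn a b %| P)%N.
  by move=> aus bus; rewrite dvdn_mull // lcmK.
set E := \sum_(a <- us) h%:R / a%:R.
set W := \sum_(a <- us) _.
pose f n := \sum_(a <- us) discrepancy h a n.
have fB n : n \in bs -> f n ^+ 2 = E ^+ 2.
  move=> nbs; rewrite -[RHS]sqrrN; congr (_ ^+ 2); rewrite /f /E -sumrN.
  apply: eq_big_seq => a aus; rewrite /discrepancy hits_eq0 ?sub0r // => i ih.
  exact: nohit.
have lower : (size bs)%:R * (K%:R ^+ 2 / 2 * E ^+ 2) <=
    \sum_(n < P) fejer R K P n * f n ^+ 2.
  have bsP n : n \in bs -> (n < P)%N.
    by move=> /bsQ nQ; apply: leq_ltn_trans nQ _; rewrite /P; nia.
  apply: (@le_trans _ _ (\sum_(n < P | (n : nat) \in bs) fejer R K P n * f n ^+ 2)); last first.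
    rewrite [leRHS](bigID (fun n : 'I_P => (n : nat) \in bs)) /= lerDl sumr_ge0 // => n _.
    by rewrite mulr_ge0 ?fejer_ge0 ?sqr_ge0.
  rewrite -(big_mkord (fun n => n \in bs) (fun n => fejer R K P n * f n ^+ 2)) -big_filter.
  rewrite (perm_big bs); last first.
    apply: uniq_perm => // [|n]; first by rewrite filter_uniq // iota_uniq.
    by rewrite mem_filter mem_index_iota /=; case: (boolP (n \in bs)) => // /bsP ->.
  rewrite mulr_natl -(count_predT bs) -iter_addr_0 -big_const_seq.
  rewrite [leLHS]big_seq [leRHS]big_seq ler_sum // => n nbs.
  rewrite fB // ler_wpM2r ?sqr_ge0 // fejer_lb //.
  by have := bsQ n nbs; rewrite /P; nia.
have upper : \sum_(n < P) fejer R K P n * f n ^+ 2 <= K%:R * (P%:R * W).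
  have -> : \sum_(n < P) fejer R K P n * f n ^+ 2 = K%:R * \sum_(a <- us) \sum_(b <- us)
      \sum_(n < P) discrepancy h a n * discrepancy h b n.
    transitivity (\sum_(a <- us) \sum_(b <- us)
        \sum_(n < P) fejer R K P n * (discrepancy h a n * discrepancy h b n)).
      under [RHS]eq_bigr => a _ do rewrite exchange_big /=.
      rewrite [RHS]exchange_big; apply: eq_bigr => n _ /=.
      rewrite expr2 mulr_suml mulr_sumr; apply: eq_bigr => a _.
      by rewrite !mulr_sumr.
    rewrite mulr_sumr; apply: eq_big_seq => a aus.
    rewrite mulr_sumr; apply: eq_big_seq => b bus.
    apply: (@sum_fejer_periodic R (fun n => discrepancy h a n * discrepancy h b n)
      P (lcmn a b)) => //.
    - by move=> n; rewrite !discrepancy_periodic ?dvdn_lcml ?dvdn_lcmr.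
    - exact: lcmP.
    - have /andP[a0 aQ] := usQ a aus; have /andP[b0 bQ] := usQ b bus.
      have : (lcmn a b <= a * b)%N.
        by apply: dvdn_leq; rewrite ?muln_gt0 ?a0 // dvdn_lcm dvdn_mulr ?dvdn_mull.
      have : (a * b <= Q * Q)%N by rewrite leq_mul.
      move=> ? ?; rewrite (mulnC K) leq_mul2r; apply/orP; right.
      by move: (Q ^ 2)%N (mulnn Q); lia.
  rewrite ler_pM2l // mulr_sumr big_seq [leRHS]big_seq ler_sum // => a aus.
  rewrite mulr_sumr big_seq [leRHS]big_seq ler_sum // => b bus.
  apply: sum_discrepancy2_le; rewrite ?lcmP //; [by case/andP: (usQ a aus)|by case/andP: (usQ b bus)].
have := le_trans lower upper.
rewrite /P -mulnn !natrM.
have -> : K%:R * (8 * (Q%:R * Q%:R) * K%:R * W) = K%:R ^+ 2 / 2 * (16 * Q%:R ^+ 2 * W) by field.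
by rewrite mulrCA ler_pM2l // divr_gt0 ?exprn_gt0.
Qed.

End Hits.

(** * Sums of gcds over a short interval *)

Section GcdSum.
Variable R : realType.
Implicit Types (X H : R) (us : seq nat) (e n Q : nat).

Lemma size_interval us X H : 0 <= X -> 0 <= H -> uniq us ->
  {in us, forall a, X < a%:R <= X + H} -> (size us)%:R <= H + 1.
Proof.
move=> X0 H0 uus usX; pose k := (Num.truncn X).+1.
have sub : {subset us <= iota k (Num.truncn H).+1}.
  move=> a /usX/andP[Xa aXH]; rewrite mem_iota.
  have ka : (k <= a)%N by rewrite /k -(ltr_nat R) (le_lt_trans _ Xa) // truncn_le.
  rewrite ka /= -ltn_subLR // ltnS truncn_ge_nat // natrB //.
  by have := truncnS_gt X; rewrite -/k; lra.
have := uniq_leq_size uus sub; rewrite size_iota -(ler_nat R) => /le_trans; apply.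
by rewrite -natr1 lerD2r truncn_le.
Qed.

(** Division by [e] carries these multiples injectively into an interval of length [H / e]. *)
Lemma size_multiples us X H e : 0 <= X -> 0 <= H -> (0 < e)%N -> uniq us ->
  {in us, forall a, X < a%:R <= X + H} ->
  (size [seq a <- us | (e %| a)%N])%:R <= H / e%:R + 1.
Proof.
move=> X0 H0 e0 uus usX; set s := [seq _ <- _ | _].
have eR : 0 < e%:R :> R by rewrite ltr0n.
rewrite -(size_map (divn^~ e)); apply: (@size_interval _ (X / e%:R)).
- by rewrite divr_ge0 // ltW.
- by rewrite divr_ge0 // ltW.
- rewrite map_inj_in_uniq ?filter_uniq // => m n.
  rewrite !mem_filter => /andP[em _] /andP[en _] mn.
  by rewrite -(divnK em) -(divnK en) mn.
- move=> _ /mapP[a + ->]; rewrite mem_filter => /andP[/dvdnP[q ->] /usX].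
  by rewrite mulnK // natrM -mulrDl ltr_pdivrMr // ler_pdivlMr.
Qed.

(** [ln (1 + t) <= t] at [t = - 1 / (n + 2)] bounds the new term by the increment of the
    logarithm. *)
Lemma sum_inv_le n : (0 < n)%N -> \sum_(e < n) (e.+1%:R)^-1 <= 1 + ln n%:R :> R.
Proof.
elim: n => // -[_ _|n IH _]; first by rewrite big_ord1 ln1 addr0 invr1.
rewrite big_ord_recr /=; have {IH} := IH isT.
have n1 : 0 < n.+1%:R :> R by rewrite ltr0n.
have n2 : 0 < n.+2%:R :> R by rewrite ltr0n.
have := @le_ln1Dx R (- (n.+2%:R)^-1).
rewrite ltrN2 invf_lt1 // ltr1n => /(_ isT).
have -> : 1 + - n.+2%:R^-1 = n.+1%:R / n.+2%:R :> R.
  by rewrite -[n.+1%:R](addrK 1) natr1; field; rewrite gt_eqF.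
rewrite ln_div ?posrE //.
by move: (ln _) (ln _) (_^-1) (\sum_(_ < _) _) => u v w t; lra.
Qed.

(** Gauss's identity for the gcd, with the divisors padded to a range independent of [a] and [b], so
    that sums can be exchanged. *)
Lemma gcdn_sum_totient a b Q : (0 < a <= Q)%N ->
  gcdn a b = (\sum_(e < Q) ((e.+1 %| a) && (e.+1 %| b)) * totient e.+1)%N.
Proof.
move=> /andP[a0 aQ]; rewrite -[LHS]cyclic.sum_totient_dvd big_mkcond big_ord_recl /=.
have g0 : (0 < gcdn a b)%N by rewrite gcdn_gt0 a0.
have gQ : (gcdn a b <= Q)%N by apply: leq_trans aQ; rewrite dvdn_leq ?dvdn_gcdl.
rewrite dvd0n eqn0Ngt g0 add0n.
rewrite (big_ord_widen Q (fun e => if (e.+1 %| gcdn a b)%N then totient e.+1 else 0%N)) //.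
rewrite big_mkcond; apply: eq_bigr => e _; rewrite -dvdn_gcd.
case: (boolP (e.+1 %| _)%N) => [eg|_]; last by rewrite mul0n if_same.
by rewrite mul1n dvdn_leq.
Qed.

Lemma totient_le n : (totient n <= n)%N.
Proof.
rewrite totient_count_coprime big_mkord -[leqRHS]card_ord -sum1_card.
by apply: leq_sum => i _; apply: leq_b1.
Qed.

(** If [c e] counts the multiples of [e] in [us], the double sum is the sum of
    [totient e * c e ^ 2]. One factor [c e] is replaced by [H / e + 1]. Its part [H / e] gives at
    most [H ^ 2 / e + H], by [totient e <= e]; its part 1 gives the sum of [totient e * c e], which
    is the sum of the elements of [us], at most [(H + 1) Q]. *)
Lemma sum_gcdn_le us X H Q : 0 <= X -> 1 <= H -> uniq us ->
  {in us, forall a, X < a%:R <= X + H} -> {in us, forall a, a <= Q}%N ->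
  \sum_(a <- us) \sum_(b <- us) (gcdn a b)%:R <=
    H ^+ 2 * (1 + ln Q%:R) + 3 * H * Q%:R.
Proof.
move=> X0 H1 uus usX usQ.
have H0 : 0 <= H by lra.
have usP a : a \in us -> (0 < a <= Q)%N.
  move=> aus; rewrite usQ // andbT -(ltr0n R).
  by have /andP[] := usX a aus; lra.
have [->|us0] := eqVneq us [::].
  rewrite big_nil; have := ler0n R Q; case: Q {usQ usP} => [|Q] Q0.
    by rewrite ln0 ?lexx // addr0 mulr1 mulr0 addr0 sqr_ge0.
  rewrite addr_ge0 // mulr_ge0 ?sqr_ge0 ?mulr_ge0 //.
  by rewrite addr_ge0 // ln_ge0 // ler1n.
have Q0 : (0 < Q)%N.
  by case: us us0 usP {uus usX usQ} => // a us _ /(_ a (mem_head _ _)) /andP[]; apply: leq_trans.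
pose c e := size [seq a <- us | (e %| a)%N].
have cE e : c e = (\sum_(a <- us) (e %| a))%N.
  by rewrite /c size_filter -sum1_count big_mkcond; apply: eq_bigr => a _; case: (_ %| _)%N.
have GE : (\sum_(a <- us) \sum_(b <- us) gcdn a b)%N =
    (\sum_(e < Q) totient e.+1 * (c e.+1 * c e.+1))%N.
  transitivity (\sum_(a <- us) \sum_(b <- us)
      \sum_(e < Q) ((e.+1 %| a) && (e.+1 %| b)) * totient e.+1)%N.
    apply: eq_big_seq => a aus; apply: eq_bigr => b _.
    exact/gcdn_sum_totient/usP.
  under eq_bigr do rewrite exchange_big /=.
  rewrite exchange_big; apply: eq_bigr => e _ /=.
  rewrite {1}cE mulnA [(totient _ * _)%N]mulnC big_distrl big_distrl; apply: eq_bigr => a _ /=.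
  rewrite cE big_distrr; apply: eq_bigr => b _ /=.
  by rewrite -mulnb; ring.
have SE : (\sum_(e < Q) totient e.+1 * c e.+1 = \sum_(a <- us) a)%N.
  transitivity (\sum_(a <- us) \sum_(e < Q) ((e.+1 %| a) && (e.+1 %| a)) * totient e.+1)%N.
    rewrite exchange_big; apply: eq_bigr => e _ /=.
    by rewrite cE mulnC big_distrl; apply: eq_bigr => a _; rewrite andbb.
  apply: eq_big_seq => a aus; rewrite -gcdn_sum_totient ?usP //.
  by rewrite gcdnn.
have cle e : (c e.+1)%:R <= H / e.+1%:R + 1 by exact: size_multiples usX.
have -> : \sum_(a <- us) \sum_(b <- us) (gcdn a b)%:R =
    \sum_(e < Q) (totient e.+1)%:R * (c e.+1)%:R * (c e.+1)%:R :> R.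
  transitivity ((\sum_(a <- us) \sum_(b <- us) gcdn a b)%N%:R : R).
    by rewrite natr_sum; apply: eq_bigr => a _; rewrite natr_sum.
  by rewrite GE natr_sum; apply: eq_bigr => e _; rewrite !natrM mulrA.
have term (e : 'I_Q) : (totient e.+1)%:R * (c e.+1)%:R * (c e.+1)%:R <=
    H ^+ 2 * (e.+1%:R)^-1 + H + (totient e.+1 * c e.+1)%:R.
  have e0 : 0 < e.+1%:R :> R by rewrite ltr0n.
  have te : (totient e.+1)%:R <= e.+1%:R :> R.
    by rewrite ler_nat totient_le.
  apply: (@le_trans _ _ ((totient e.+1)%:R * (c e.+1)%:R * (H / e.+1%:R + 1))).
    by rewrite ler_wpM2l // mulr_ge0.
  rewrite mulrDr mulr1 natrM lerD2r.
  apply: (@le_trans _ _ (e.+1%:R * (c e.+1)%:R * (H / e.+1%:R))).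
    by apply: ler_wpM2r; [rewrite divr_ge0 // ltW | exact: ler_wpM2r].
  have -> : e.+1%:R * (c e.+1)%:R * (H / e.+1%:R) = H * (c e.+1)%:R by field; lra.
  have := ler_wpM2l H0 (cle e); rewrite mulrDr mulr1 => /le_trans; apply.
  by rewrite expr2 mulrA lexx.
have szus : (size us)%:R <= H + 1 by exact: size_interval usX.
apply: (@le_trans _ _ (\sum_(e < Q) (H ^+ 2 * (e.+1%:R)^-1 + H + (totient e.+1 * c e.+1)%:R))).
  by apply: ler_sum => e _; apply: term.
rewrite !big_split /= -mulr_sumr sumr_const card_ord -natr_sum SE.
have : ((\sum_(a <- us) a)%N%:R : R) <= (size us)%:R * Q%:R.
  rewrite -natrM ler_nat -sum1_size big_distrl /= big_seq [leqRHS]big_seq leq_sum // => a aus.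
  by rewrite mul1n usQ.
have := ler_wpM2l (sqr_ge0 H) (sum_inv_le Q0).
have := ler_wpM2r (ler0n R Q) szus.
have := ler_wpM2r (ler0n R Q) H1.
rewrite -mulr_natr.
by lra.
Qed.
End GcdSum.

(** * Products [a * b * m] just beyond [X ^+ 3] *)

Section Bilinear.
Variable R : realType.
Implicit Types (X H y l u v : R) (us vs : seq nat) (a b c h n : nat).

Lemma next_multiple (z : R) (d : nat) : 0 <= z -> (0 < d)%N ->
  exists m : nat, z < (d * m)%:R <= z + d%:R.
Proof.
move=> z0 d0; have dR : 0 < d%:R :> R by rewrite ltr0n.
exists (Num.truncn (z / d%:R)).+1; rewrite natrM.
have zd : 0 <= z / d%:R by rewrite divr_ge0 // ltW.
have /andP[lo hi] := truncn_itv zd.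
rewrite mulrC -ltr_pdivrMr // hi /=.
by rewrite -natr1 mulrDl mul1r lerD2r -ler_pdivlMr.
Qed.

Lemma uniq_blocks (f : nat -> nat) vs (h : nat) :
  uniq vs -> {in vs &, forall b c, f b <= f c < f b + h -> b = c}%N ->
  uniq [seq (f b + t)%N | b <- vs, t <- iota 0 h].
Proof.
move=> uvs sep; apply: allpairs_uniq => //; first exact: iota_uniq.
move=> [b t] [c s] /allpairsP[[b' t'] /= [bvs +]] [-> ->].
rewrite mem_iota /= => th /allpairsP[[c' s'] /= [cvs + [-> ->]]].
rewrite mem_iota /= => sh e.
have bc : b' = c'.
  by case/orP: (leq_total (f b') (f c')) => le; [|symmetry]; apply: sep => //; lia.
by rewrite bc in e *; congr pair; move: e; lia.
Qed.

(** The first integer [n] with [n * b > X ^+ 3]. *)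
Definition block_start X (b : nat) := (Num.truncn (X ^+ 3 / b%:R)).+1.

Lemma block_startP X b :
  0 < X -> X < b%:R <= 2 * X -> X ^+ 3 < (block_start X b)%:R * b%:R <= X ^+ 3 + b%:R.
Proof.
move=> X0 /andP[Xb bX]; have bR : 0 < b%:R :> R by lra.
have X30 : 0 <= X ^+ 3 by rewrite exprn_ge0 // ltW.
have : 0 <= X ^+ 3 / b%:R by rewrite divr_ge0 // ltW.
move=> /truncn_itv /andP[lo hi].
rewrite -ltr_pdivrMr // hi /= -natr1 mulrDl mul1r lerD2r.
by rewrite -ler_pdivlMr.
Qed.

Lemma block_start_gt X b :
  0 < X -> X < b%:R <= 2 * X -> X ^+ 2 / 2 < (block_start X b)%:R.
Proof.
move=> X0 bw; have /andP[fb _] := block_startP X0 bw; have /andP[Xb bX] := bw.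
have : (block_start X b)%:R * b%:R <= (block_start X b)%:R * (2 * X) :> R by rewrite ler_wpM2l.
move=> /(lt_le_trans fb) ?; rewrite ltr_pdivrMr // -(ltr_pM2l X0) -exprS.
by lra.
Qed.

Lemma block_start_le X b :
  0 < X -> X < b%:R <= 2 * X -> (block_start X b)%:R <= X ^+ 2 + 1.
Proof.
move=> X0 bw; have /andP[_ fb] := block_startP X0 bw; have /andP[Xb bX] := bw.
have bR : 0 < b%:R :> R by lra.
rewrite -(ler_pM2r bR); apply: le_trans fb _.
have : X ^+ 2 * X <= X ^+ 2 * b%:R by rewrite ler_wpM2l ?sqr_ge0 // ltW.
by rewrite -exprSr; lra.
Qed.

(** For distinct [b], [c] in [(X, 2 X]] the quotients [X^3 / b] and [X^3 / c] differ by at least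
    [X / 4], while [h <= X / 8]; the rest absorbs the rounding. *)
Lemma block_start_sep X b c h :
  4 <= X -> h%:R <= X / 8 -> X < b%:R <= 2 * X -> X < c%:R <= 2 * X ->
  (block_start X b <= block_start X c < block_start X b + h)%N -> b = c.
Proof.
move=> X4 hX bw cw; have X0 : 0 < X by lra.
rewrite -!(ler_nat R) natrD -natr1 => /andP[fbc fcb].
have /andP[Xb bX] := bw; have /andP[Xc cX] := cw.
have /andP[fb1 fb2] := block_startP X0 bw; have /andP[fc1 fc2] := block_startP X0 cw.
have fbX := block_start_gt X0 bw.
have XX : X * 4 <= X * X by rewrite ler_pM2l.
have [bc|cb|//] := ltngtP b c; exfalso.
  move: bc; rewrite -(ler_nat R) -natr1 => bc.
  have s1 : (block_start X b)%:R * b%:R <= (block_start X c)%:R * b%:R :> R by rewrite ler_wpM2r.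
  have s2 : (block_start X c)%:R * (b%:R + 1) <= (block_start X c)%:R * c%:R :> R by rewrite ler_wpM2l.
  by lra.
move: cb; rewrite -(ler_nat R) -natr1 => cb.
have c0 : 0 <= c%:R :> R by [].
have s1 : (block_start X c)%:R * c%:R <= ((block_start X b)%:R + h%:R - 1) * c%:R :> R.
  by rewrite ler_wpM2r // lerBrDr.
have s2 : h%:R * c%:R <= X / 8 * (2 * X) by rewrite ler_pM.
have s3 : ((block_start X b)%:R - 1) * (c%:R + 1) <= ((block_start X b)%:R - 1) * b%:R :> R.
  by rewrite ler_wpM2l //; lra.
by lra.
Qed.

(* The large sieve is applied to the blocks of [h] integers starting at
   [block_start X b], [b] in [vs]. *)
Lemma no_product_bound X y us vs h :
  4 <= X -> (0 < h)%N -> h%:R <= X / 8 -> h%:R * (32 * X) <= y ->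
  {in us, forall a, X < a%:R <= 2 * X} -> uniq vs -> {in vs, forall b, X < b%:R <= 2 * X} ->
  (forall a b m, a \in us -> b \in vs ->
     ~~ (X ^+ 3 < (a * b * m)%:R <= X ^+ 3 + y)) ->
  (size vs)%:R * (size us)%:R ^+ 2 * h%:R ^+ 2 <=
    256 * (X ^+ 2 * \sum_(a <- us) \sum_(b <- us) (gcdn a b)%:R).
Proof.
move=> X4 h0 hX hy usX uvs vsX nohit.
have X0 : 0 < X by lra.
have hR : 0 < h%:R :> R by rewrite ltr0n.
pose Q := Num.truncn (2 * X).
have /andP[Q2 Q1] : Q%:R <= 2 * X < Q.+1%:R by apply: truncn_itv; lra.
have win0 b : X < b%:R <= 2 * X -> (0 < b)%N.
  by move=> /andP[Xb _]; rewrite -(ltr0n R); lra.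
pose bs := [seq (block_start X b + t)%N | b <- vs, t <- iota 0 h].
have ubs : uniq bs.
  by apply: uniq_blocks => // b c bvs cvs; apply: (block_start_sep X4 hX); apply: vsX.
have membs n : n \in bs -> exists b t, [/\ b \in vs, (t < h)%N & n = block_start X b + t]%N.
  by move=> /allpairsP[[b t] /= [bvs]]; rewrite mem_iota => /= th ->; exists b, t.
(* The blocks stay below [X ^+ 2 + 1 + X / 8], hence below [(2 * X - 1) ^+ 2 < Q ^ 2], as
   [X >= 4]. *)
have bsQ : {in bs, forall n, n <= Q ^ 2}%N.
  move=> n /membs[b [t [bvs th ->]]].
  have fb := block_start_le X0 (vsX b bvs).
  rewrite -(ler_nat R) natrX natrD.
  have tR : t%:R <= h%:R :> R by rewrite ler_nat ltnW.
  have : (2 * X - 1) ^+ 2 <= Q%:R ^+ 2.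
    by move: Q1; rewrite -natr1 => Q1; rewrite ler_pXn2r ?nnegrE //; lra.
  have XX : X * 4 <= X * X by rewrite ler_pM2l.
  by lra.
have nomult n a i : n \in bs -> a \in us -> (i < h)%N -> ~~ (a %| n + i.+1)%N.
  move=> /membs[b [t [bvs th ->]]] aus ih; apply/negP => /dvdnP[m mE].
  apply/negP: (nohit a b m aus bvs); apply/negPn.
  have /andP[Xb bX] := vsX b bvs.
  have bR : 0 < b%:R :> R by lra.
  have /andP[fb1 fb2] := block_startP X0 (vsX b bvs).
  have -> : (a * b * m)%:R = (block_start X b)%:R * b%:R + (t + i.+1)%:R * b%:R :> R.
    by rewrite -mulrDl -natrD -natrM; congr _%:R; rewrite addnA mE; ring.
  (* Here [t <= h - 1] and [i.+1 <= h]. With at most one more [b] from [block_startP], the product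
     exceeds [X ^+ 3] by at most [2 h b <= 4 h X <= y]. *)
  have ti : (t + i.+1)%:R <= 2 * h%:R - 1 :> R.
    have : ((t + i.+1).+1 <= 2 * h)%N by move: th ih; clear; lia.
    by rewrite -(ler_nat R) -natr1 natrM; lra.
  have tib : (t + i.+1)%:R * b%:R <= (2 * h%:R - 1) * b%:R :> R.
    by rewrite ler_wpM2r // ltW.
  have hb : h%:R * b%:R <= h%:R * (2 * X) by rewrite ler_pM2l.
  have : 0 < (t + i.+1)%:R * b%:R :> R by rewrite mulr_gt0 // ltr0n addnS.
  have hX0 : 0 < h%:R * X by rewrite mulr_gt0.
  by move=> ?; apply/andP; split; lra.
have usQ : {in us, forall a, 0 < a <= Q}%N.
  move=> a /usX aw; rewrite win0 //= truncn_ge_nat; last by lra.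
  by case/andP: aw.
have := @large_sieve R Q h us bs usQ ubs bsQ nomult.
rewrite size_allpairs size_iota natrM.
set u : R := (size us)%:R; set v : R := (size vs)%:R.
set E := \sum_(a <- us) h%:R / a%:R.
set G := \sum_(a <- us) \sum_(b <- us) (gcdn a b)%:R.
set W := \sum_(a <- us) \sum_(b <- us) _ => main.
have Ele : u * h%:R / (2 * X) <= E.
  rewrite -mulrA /u mulr_natl -(count_predT us) -iter_addr_0 -big_const_seq.
  rewrite /E [leLHS]big_seq [leRHS]big_seq ler_sum // => a /usX/andP[Xa aX].
  by rewrite ler_wpM2l // lef_pV2 ?posrE //; lra.
have Wle : W <= h%:R / X ^+ 2 * G.
  rewrite /W /G mulr_sumr [leLHS]big_seq [leRHS]big_seq ler_sum // => a /usX/andP[Xa _].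
  rewrite mulr_sumr [leLHS]big_seq [leRHS]big_seq ler_sum // => b /usX/andP[Xb _].
  rewrite mulrAC ler_wpM2r // ler_wpM2l // lef_pV2 ?posrE ?exprn_gt0 ?mulr_gt0 //; try lra.
  by rewrite expr2 ler_pM // ltW.
have W0 : 0 <= W.
  by apply: sumr_ge0 => a _; apply: sumr_ge0 => b _; rewrite divr_ge0 ?mulr_ge0.
have step : v * h%:R * (u * h%:R / (2 * X)) ^+ 2 <=
    16 * (2 * X) ^+ 2 * (h%:R / X ^+ 2 * G).
  have EE : (u * h%:R / (2 * X)) ^+ 2 <= E ^+ 2.
    have E0 : 0 <= u * h%:R / (2 * X) by rewrite divr_ge0 ?mulr_ge0 ?(ltW X0).
    by rewrite ler_pXn2r // nnegrE // (le_trans E0).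
  apply: (@le_trans _ _ (v * h%:R * E ^+ 2)); first by rewrite ler_wpM2l ?mulr_ge0.
  apply: (le_trans main); apply: ler_pM => //.
  by rewrite ler_wpM2l // ler_pXn2r ?nnegrE //; lra.
(* This factor clears the denominators and turns 16 into [256 = 4 * 16 * 4]. *)
have XX : 0 < 4 * X ^+ 2 / h%:R by rewrite divr_gt0 ?mulr_gt0 ?exprn_gt0.
rewrite -(ler_pM2l XX) in step.
have e1 : 4 * X ^+ 2 / h%:R * (v * h%:R * (u * h%:R / (2 * X)) ^+ 2) =
    v * u ^+ 2 * h%:R ^+ 2 by field; rewrite !gt_eqF.
have e2 : 4 * X ^+ 2 / h%:R * (16 * (2 * X) ^+ 2 * (h%:R / X ^+ 2 * G)) =
    256 * (X ^+ 2 * G) by field; rewrite !gt_eqF.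
by rewrite e1 e2 in step.
Qed.

(** Otherwise the trivial bounds on [u] and [v] make the square at most [2^14 X^2 H^4], which is too
    small since [H <= X]. This ensures that the block length [h] is at least 1. *)
Lemma interval_length_ge X H l u v y :
  4 <= X -> 1 <= H -> H <= X -> 1 <= l -> 0 <= u <= 2 * H -> 0 <= v <= 2 * H ->
  0 < y -> 2 ^+ 26 * X ^+ 5 * l ^+ 3 * H ^+ 2 <= (y * (u * v)) ^+ 2 -> 32 * X <= y.
Proof.
move=> X4 H1 HX l1 /andP[u0 uH] /andP[v0 vH] y0 yuv.
have X0 : 0 < X by lra.
have H0 : 0 < H by lra.
rewrite leNgt; apply/negP => ylt.
have bnd : y * (u * v) <= 32 * X * (2 * H * (2 * H)).
  by rewrite ler_pM ?mulr_ge0 //; first [exact: ltW | exact: ler_pM].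
have : (y * (u * v)) ^+ 2 <= (32 * X * (2 * H * (2 * H))) ^+ 2.
  have A0 : 0 <= y * (u * v) by rewrite !mulr_ge0 // ltW.
  by rewrite ler_pXn2r // nnegrE // (le_trans A0).
rewrite leNgt => /negP; apply; apply: lt_le_trans yuv.
have H2X : H ^+ 2 <= X ^+ 2 by rewrite ler_pXn2r // nnegrE ltW.
have X2H : 0 < X ^+ 2 * H ^+ 2 by rewrite mulr_gt0 ?exprn_gt0.
have l3 : 1 <= l ^+ 3 by rewrite exprn_ege1.
have XX : X ^+ 2 <= X ^+ 3 by rewrite ler_weXn2l //; lra.
have Xl : H ^+ 2 * 1 <= X ^+ 3 * l ^+ 3.
  by rewrite ler_pM ?exprn_ge0 ?(ltW H0) // (le_trans H2X).
have := Xl; rewrite -(ler_pM2l X2H).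
have -> : (32 * X * (2 * H * (2 * H))) ^+ 2 =
  2 ^+ 14 * (X ^+ 2 * H ^+ 2 * (H ^+ 2 * 1)) by ring.
have -> : 2 ^+ 26 * X ^+ 5 * l ^+ 3 * H ^+ 2 =
  2 ^+ 26 * (X ^+ 2 * H ^+ 2 * (X ^+ 3 * l ^+ 3)) by ring.
have : 0 < X ^+ 2 * H ^+ 2 * (X ^+ 3 * l ^+ 3) by rewrite !mulr_gt0 ?exprn_gt0 //; lra.
by move: (_ * (_ * _)) (_ * (_ ^+ 2 * 1)) => p q; lra.
Qed.

(** Without a product, [no_product_bound], [y <= 64 X h] and the gcd sum bound would give
    [(y u v)^2 <= 9 * 2^21 X^5 H^2 l], below the assumed [2^26 X^5 l^3 H^2]. The last conjunct keeps
    the product near [X ^+ 3] even when [y] is large. *)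
Lemma exists_product X H y l us vs :
  4 <= X -> 1 <= H -> H <= X -> 0 < y -> 1 <= l -> ln (2 * X) <= 2 * l ->
  uniq us -> {in us, forall a, X < a%:R <= X + H} ->
  uniq vs -> {in vs, forall b, X < b%:R <= X + H} ->
  2 ^+ 26 * X ^+ 5 * l ^+ 3 * H ^+ 2 <= (y * ((size us)%:R * (size vs)%:R)) ^+ 2 ->
  exists a b m : nat, [/\ a \in us, b \in vs,
    X ^+ 3 < (a * b * m)%:R <= X ^+ 3 + y & (a * b * m)%:R <= X ^+ 3 + 4 * X ^+ 2].
Proof.
move=> X4 H1 HX y0 l1 lnX uus usX uvs vsX yuv.
have X0 : 0 < X by lra.
have H0 : 0 < H by lra.
have win (ws : seq nat) : {in ws, forall b : nat, X < b%:R <= X + H} ->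
    {in ws, forall b : nat, X < b%:R <= 2 * X}.
  by move=> wsX b /wsX/andP[Xb bX]; rewrite Xb; lra.
have {}vsX' := win vs vsX; have usX' := win us usX.
have us2 : (size us)%:R <= 2 * H by have := size_interval (ltW X0) (ltW H0) uus usX; lra.
have vs2 : (size vs)%:R <= 2 * H by have := size_interval (ltW X0) (ltW H0) uvs vsX; lra.
have lhs0 : 0 < 2 ^+ 26 * X ^+ 5 * l ^+ 3 * H ^+ 2.
  by rewrite !mulr_gt0 ?exprn_gt0 //; lra.
have [y4|y4] := lerP (4 * X ^+ 2) y.
  (* The assumed lower bound makes both lists nonempty, and the next multiple of
     [a * b <= 4 * X ^+ 2] is already within reach. *)
  have : (size us * size vs)%:R != 0 :> R.
    apply/eqP; rewrite natrM => uv0.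
    by move: yuv; rewrite uv0 mulr0 expr0n leNgt lhs0.
  rewrite pnatr_eq0 muln_eq0 negb_or !size_eq0.
  case: us usX' {usX uus us2 yuv} => // a us usX' /=.
  case: vs vsX' {vsX uvs vs2} => // b vs vsX' _.
  have /andP[Xa aX] := usX' a (mem_head _ _); have /andP[Xb bX] := vsX' b (mem_head _ _).
  have [| |m /andP[lo hi]] := @next_multiple (X ^+ 3) (a * b).
  - by rewrite exprn_ge0 // ltW.
  - by rewrite -(ltr0n R) natrM mulr_gt0 //; lra.
  have ab : (a * b)%:R <= 2 * X * (2 * X) by rewrite natrM ler_pM.
  have hi' := le_trans hi (lerD (lexx _) ab).
  by exists a, b, m; split; rewrite ?mem_head ?lo //=; apply: (le_trans hi'); lra.
have y32 : 32 * X <= y.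
  by apply: interval_length_ge yuv; rewrite ?us2 ?vs2 ?ler0n.
(* [y >= 32 X] gives [h >= 1], so truncation loses at most a factor 2; [y < 4 X^2] gives
   [h <= X / 8]. *)
pose h := Num.truncn (y / (32 * X)).
have X32 : 0 < 32 * X by rewrite mulr_gt0.
have /andP[hle hgt] : h%:R <= y / (32 * X) < h.+1%:R.
  by apply: truncn_itv; rewrite divr_ge0 // ltW.
have h1 : 1 <= h%:R :> R by rewrite ler1n truncn_gt0 ler_pdivlMr // mul1r.
move: hle; rewrite ler_pdivlMr // => hle.
have ylt : y <= 64 * X * h%:R.
  move: hgt; rewrite -[h.+1%:R]natr1 ltr_pdivrMr //.
  by have := ler_wpM2r (ltW X0) h1; lra.
have hX : h%:R <= X / 8.
  by rewrite -(ler_pM2r X32); apply: le_trans hle _; lra.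
apply: contrapT => nohit.
pose G : R := \sum_(a <- us) \sum_(b <- us) (gcdn a b)%:R.
have key : (size vs)%:R * (size us)%:R ^+ 2 * h%:R ^+ 2 <= 256 * (X ^+ 2 * G).
  apply: (no_product_bound X4 _ hX hle) => //; first by rewrite -(ltr0n R); lra.
  move=> a b m aus bvs; apply/negP => /andP[lo hi]; apply: nohit.
  by exists a, b, m; split=> //; [rewrite lo|lra].
(* The logarithmic part is at most [3 X H l], and [3 H Q <= 6 X H <= 6 X H l]. *)
have G9 : G <= 9 * X * H * l.
  pose Q := Num.truncn (2 * X).
  have /andP[Q2 Q1] : Q%:R <= 2 * X < Q.+1%:R by apply: truncn_itv; lra.
  have Q0 : 0 < Q%:R :> R by move: Q1; rewrite -natr1; lra.
  have Gle : G <= H ^+ 2 * (1 + ln Q%:R) + 3 * H * Q%:R.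
    apply: (sum_gcdn_le (ltW X0) H1 uus usX) => a /usX'/andP[_ aX].
    by rewrite truncn_ge_nat //; lra.
  have lnQ : ln Q%:R <= 2 * l by apply: le_trans lnX; rewrite ler_ln ?posrE //; lra.
  have H2 : H ^+ 2 * (1 + ln Q%:R) <= H * X * (3 * l).
    have ln0 : 0 <= ln Q%:R :> R by rewrite ln_ge0 // ler1n -(ltr0n R).
    by rewrite ler_pM ?sqr_ge0 //; [lra|rewrite expr2 ler_pM2l|lra].
  have HQ : H * Q%:R <= H * (2 * X) by rewrite ler_pM2l.
  have : H * X * 1 <= H * X * l by rewrite ler_pM2l ?mulr_gt0.
  by lra.
move: yuv us2 vs2 key; set u : R := (size us)%:R; set v : R := (size vs)%:R.
have u0 : 0 <= u by []; have v0 : 0 <= v by [].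
move: u v u0 v0 => u v u0 v0 yuv us2 vs2 key.
have hi : (y * (u * v)) ^+ 2 <= 64 ^+ 2 * X ^+ 2 * (2 * H * (256 * (X ^+ 2 * (9 * X * H * l)))).
  apply: (@le_trans _ _ ((64 * X * h%:R * (u * v)) ^+ 2)).
    have B0 : 0 <= 64 * X * h%:R by rewrite !mulr_ge0 // ltW.
    have uv0 : 0 <= u * v by rewrite mulr_ge0.
    by rewrite ler_pXn2r ?nnegrE ?(mulr_ge0 B0) ?(mulr_ge0 (ltW y0)) // ler_wpM2r.
  have -> : (64 * X * h%:R * (u * v)) ^+ 2 = 64 ^+ 2 * X ^+ 2 * (v * (v * u ^+ 2 * h%:R ^+ 2)) by ring.
  rewrite ler_wpM2l ?mulr_ge0 ?exprn_ge0 ?(ltW X0) //.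
  rewrite ler_pM ?mulr_ge0 ?exprn_ge0 //; apply: le_trans key _.
  by rewrite ler_pM2l // ler_pM2l ?exprn_gt0.
have := le_trans yuv hi; rewrite leNgt => /negP; apply.
have -> : 64 ^+ 2 * X ^+ 2 * (2 * H * (256 * (X ^+ 2 * (9 * X * H * l)))) =
  2 ^+ 21 * 9 * (X ^+ 5 * H ^+ 2 * l) by ring.
have -> : 2 ^+ 26 * X ^+ 5 * l ^+ 3 * H ^+ 2 = 2 ^+ 21 * 32 * (X ^+ 5 * H ^+ 2 * l * l ^+ 2) by ring.
have P0 : 0 < X ^+ 5 * H ^+ 2 * l by rewrite !mulr_gt0 ?exprn_gt0 //; lra.
have l2 : 1 <= l ^+ 2 by rewrite exprn_ege1.
have := ler_wpM2l (ltW P0) l2; rewrite mulr1.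
have c0 : 0 < 2 ^+ 21 :> R by rewrite exprn_gt0.
move: (X ^+ 5 * H ^+ 2 * l) P0 (l ^+ 2) (2 ^+ 21 : R) c0 => p p0 q c c0 pq.
by rewrite -!(mulrA c) ltr_pM2l //; lra.
Qed.
End Bilinear.

(** * From dense sets to almost cubes *)

Section Main.
Variable R : realType.
Implicit Types (X H x theta : R) (A : set nat) (F : R -> R).

(** The cube root [c] lies in [(X, X + 2]], and [m = n / (a b)] lies between
    [X^3 / (X + H)^2 >= X - 2 H] and [(X^3 + 4 X^2) / X^2 = X + 4]. *)
Lemma close_factors X H n a b m (c := (n%:R : R) `^ (1 / 3)) :
  1 <= X -> 1 <= H -> n = (a * b * m)%N ->
  X < a%:R <= X + H -> X < b%:R <= X + H ->
  X ^+ 3 < n%:R <= X ^+ 3 + 4 * X ^+ 2 ->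
  [/\ `|a%:R - c| <= 4 * H, `|b%:R - c| <= 4 * H & `|m%:R - c| <= 4 * H].
Proof.
move=> X1 H1 nE /andP[Xa aX] /andP[Xb bX] /andP[nlo nhi].
have X0 : 0 < X by lra.
have c0 : 0 <= c := powR_ge0 _ _.
have c3 : c ^+ 3 = n%:R.
  by rewrite -powR_mulrn // -powRrM mulfVK ?pnatr_eq0 // powRr1.
have cX : X < c by rewrite -(@ltr_pXn2r _ 3) ?nnegrE ?c3 // ltW.
have Xc : c <= X + 2.
  rewrite -(@ler_pXn2r _ 3) ?nnegrE // ?c3; last by lra.
  have : 0 < X ^+ 2 by rewrite exprn_gt0.
  have -> : (X + 2) ^+ 3 = X ^+ 3 + 6 * X ^+ 2 + 12 * X + 8 by ring.
  by lra.
have nR : n%:R = a%:R * b%:R * m%:R :> R by rewrite nE !natrM.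
have m0 : 0 <= m%:R :> R by [].
have mhi : m%:R <= X + 4.
  have X2 : 0 < X * X by rewrite mulr_gt0.
  rewrite -(ler_pM2l X2).
  have : X * X * m%:R <= a%:R * b%:R * m%:R.
    by rewrite ler_wpM2r // ler_pM // ltW.
  by lra.
have mlo : X - 2 * H <= m%:R.
  have [XH|XH] := lerP (X - 2 * H) 0; first by lra.
  have XH2 : 0 < (X + H) * (X + H) by rewrite mulr_gt0 //; lra.
  rewrite -(ler_pM2l XH2).
  have : a%:R * b%:R * m%:R <= (X + H) * (X + H) * m%:R.
    by rewrite ler_wpM2r // ler_pM // ltW // (lt_trans X0).
  have : 0 <= X * H ^+ 2 by rewrite mulr_ge0 ?sqr_ge0 // ltW.
  have : 0 <= H ^+ 3 by rewrite exprn_ge0 //; lra.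
  by lra.
by split; rewrite ler_norml; apply/andP; split; lra.
Qed.

(** Density is used with [X' = X^theta], admissible for the constants 1 and 2 because [theta <= 1].
    Listing the finite window without repetition turns the sum over a set into a size. *)
Lemma dense_window A F theta : theta <= 1 -> short_almost_dense theta A F ->
  exists2 M : R, 1 <= M & forall X (H := X `^ theta), M <= X ->
    0 < F X /\ exists us : seq nat, [/\ uniq us,
      {in us, forall a, A a}, {in us, forall a, X < a%:R <= X + H} &
      F X * H <= (size us)%:R].
Proof.
move=> theta1 [_ _ Fpos _ /(_ 1 2 ltr01 (ltr1n R 2))] [M0 [_ HM]].
have M0_ge0 : 0 <= `|M0| by [].
exists (1 + `|M0|) => [|X H MX]; first by lra.
have X1 : 1 <= X by lra.
have HX : H <= X by rewrite -[leRHS]powRr1 ?ler_powR //; lra.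
split; first exact: Fpos.
set P := fun a : nat => `[< A a >] && (X < a%:R <= X + H).
pose us := [seq a <- iota 0 (Num.truncn (X + H)).+1 | P a].
have usE a : (a \in us) = P a.
  rewrite mem_filter mem_iota /= add0n ltnS andb_idr // => /andP[_ /andP[_ aXH]].
  by rewrite truncn_ge_nat // (le_trans _ aXH).
exists us; split=> [|a|a|]; rewrite ?usE ?filter_uniq ?iota_uniq //.
- by case/andP => /asboolP.
- by case/andP.
have := HM X _ H; rewrite mul1r => /(_ _ (lexx _) _) /le_trans; apply.
- by have := ler_norm M0; lra.
- by lra.
have -> : [set n | A n /\ X < n%:R <= X + H] = [set` us].
  apply/seteqP; split=> a /=; rewrite usE.
    by case=> Aa aX; apply/andP; split=> //; apply/asboolP.
  by case/andP=> /asboolP.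
rewrite -fsbig_seq ?filter_uniq ?iota_uniq //.
by rewrite big_const_seq count_predT iter_addr_0.
Qed.

(** [ln (1 - 1/2) <= - 1/2] gives [ln 2 >= 1/2], and [ln 4 = 2 ln 2]. *)
Lemma ln_ge1 x : 4 <= x -> 1 <= ln x.
Proof.
move=> x4; have ln2 : 1 / 2 <= ln 2 :> R.
  have := @le_ln1Dx R (- 2^-1).
  have -> : 1 + - 2^-1 = 2^-1 :> R by lra.
  by rewrite lnV ?posrE // => /(_ _); lra.
have : ln 4 <= ln x by rewrite ler_ln ?posrE //; lra.
have -> : 4 = 2 ^+ 2 :> R by lra.
by rewrite lnXn // mulr2n; lra.
Qed.

(** As [H = x^(theta/3)], the power of [x] times [H] is [x^(5/6)], with square [X^5]. The values of
    [F1] and [F2] cancel, leaving the threshold of [exists_product]. *)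
Lemma interval_length_sqr theta (F1 F2 : R -> R) x (X := x `^ (1 / 3)) (H := X `^ theta) :
  1 < x -> 0 < F1 X -> 0 < F2 X ->
  (interval_length theta (2 ^+ 13) F1 F2 x * (F1 X * H * (F2 X * H))) ^+ 2 =
    2 ^+ 26 * X ^+ 5 * ln x ^+ 3 * H ^+ 2.
Proof.
move=> x1 F10 F20; rewrite /interval_length -/X.
have x0 : 0 < x by lra.
have l0 : 0 < ln x by rewrite ln_gt0.
set p := x `^ _; set q := _ `^ (3 / 2).
have q2 : q ^+ 2 = ln x ^+ 3.
  by rewrite -!powR_mulrn ?powR_ge0 ?(ltW l0) // -powRrM mulfVK ?pnatr_eq0.
have p2 : (p * H) ^+ 2 = X ^+ 5.
  have -> : p * H = x `^ (5 / 6).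
    rewrite /p /H /X -powRrM -powRD; last by rewrite (gt_eqF x0) implybT.
    by congr (_ `^ _); field.
  transitivity (x `^ (5 / 3)).
    by rewrite -powR_mulrn ?powR_ge0 // -powRrM; congr (_ `^ _); field.
  by rewrite -powR_mulrn ?powR_ge0 // -powRrM; congr (_ `^ _); field.
have -> : 2 ^+ 13 * (p * q / (F1 X * F2 X)) * (F1 X * H * (F2 X * H)) =
  2 ^+ 13 * (p * H) * q * H by field; rewrite !gt_eqF.
have -> : (2 ^+ 13 * (p * H) * q * H) ^+ 2 =
  2 ^+ 26 * (p * H) ^+ 2 * q ^+ 2 * H ^+ 2 by ring.
by rewrite p2 q2.
Qed.
End Main.

Theorem theorem1 (R : realType) (theta : R) (A1 A2 : set nat) (F1 F2 : R -> R)
    (theta_gt : 1 / 4 < theta) (theta_le : theta <= 1)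
    (A1_dense : short_almost_dense theta A1 F1)
    (A2_dense : short_almost_dense theta A2 F2) :
  exists C K x0 : R, [/\ 0 < C, 0 < K, 10 <= x0 &
    forall x : R, x0 <= x ->
      exists n a1 a2 m : nat,
        [/\ x < n%:R <= x + interval_length theta C F1 F2 x,
            short_almost_cube theta K K K n,
            n = (a1 * a2 * m)%N /\ (0 < m)%N,
            A1 a1 /\ A2 a2 &
            [/\ close_to_cbrt theta K n a1,
                close_to_cbrt theta K n a2 &
                close_to_cbrt theta K n m]]].
Proof.
have [M1 M1ge HM1] := dense_window theta_le A1_dense.
have [M2 M2ge HM2] := dense_window theta_le A2_dense.
(* [N] dominates both density thresholds and 4; [x >= N ^+ 3] then means [X >= N]. *)
pose N := 4 + M1 + M2.
have N4 : 4 <= N by rewrite /N; lra.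
have N3 : 64 <= N ^+ 3.
  have -> : 64 = 4 ^+ 3 :> R by ring.
  by rewrite ler_pXn2r // nnegrE; lra.
(* [2 ^+ 13] is the square root of the constant in [exists_product], and 4 comes from
   [close_factors]. *)
exists (2 ^+ 13), 4, (N ^+ 3); split=> // [|x Nx]; first by lra.
pose X := x `^ (1 / 3); pose H := X `^ theta.
have X30 : X ^+ 3 = x.
  by rewrite -powR_mulrn ?powR_ge0 // -powRrM mulfVK ?pnatr_eq0 // powRr1 //; lra.
have NX : N <= X.
  by rewrite -(@ler_pXn2r _ 3) ?nnegrE ?powR_ge0 // ?X30 //; lra.
have X4 : 4 <= X by lra.
have H1 : 1 <= H.
  by rewrite -(powRr0 X) /H ler_powR //; lra.
have HX : H <= X by rewrite -[leRHS]powRr1 ?ler_powR //; lra.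
have [F10 [us [uus usA usX Fus]]] := HM1 X ltac:(rewrite /N in NX; lra).
have [F20 [vs [uvs vsA vsX Fvs]]] := HM2 X ltac:(rewrite /N in NX; lra).
rewrite -/H in usX vsX Fus Fvs.
set y := interval_length _ _ _ _ _.
have l1 : 1 <= ln x by apply: ln_ge1; lra.
have y0 : 0 < y.
  by rewrite mulr_gt0 ?exprn_gt0 // divr_gt0 ?mulr_gt0 ?powR_gt0 //; lra.
have lnX : ln (2 * X) <= 2 * ln x.
  have : ln (2 * X) <= ln x by rewrite ler_ln ?posrE -?X30; nra.
  by lra.
have Y : 2 ^+ 26 * X ^+ 5 * ln x ^+ 3 * H ^+ 2 <= (y * ((size us)%:R * (size vs)%:R)) ^+ 2.
  rewrite -(@interval_length_sqr R theta F1 F2 x) //; last by lra.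
  have FH1 : 0 <= F1 X * H by rewrite mulr_ge0 ?(ltW F10) //; lra.
  have FH2 : 0 <= F2 X * H by rewrite mulr_ge0 ?(ltW F20) //; lra.
  have uv : F1 X * H * (F2 X * H) <= (size us)%:R * (size vs)%:R by rewrite ler_pM.
  have yuv := ler_wpM2l (ltW y0) uv.
  have yFH : 0 <= y * (F1 X * H * (F2 X * H)) by rewrite mulr_ge0 ?(mulr_ge0 FH1) ?(ltW y0).
  by rewrite ler_pXn2r ?nnegrE //; first [exact: yuv | exact: yFH | exact: le_trans yFH yuv].
have [a [b [m [aus bvs]]]] := exists_product X4 H1 HX y0 l1 lnX uus usX uvs vsX Y.
rewrite X30 => /andP[lo hi] hi4.
set n := (a * b * m)%N in lo hi hi4.
have [|| ca cb cm] := @close_factors R X H n a b m _ H1 erefl (usX a aus) (vsX b bvs).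
- by lra.
- by rewrite X30 lo.
(* [H] is [x^(theta/3)] and [x < n], so errors of size [4 H] become errors in terms of [n]. *)
have Hn : H <= n%:R `^ (theta / 3).
  have -> : H = x `^ (theta / 3) by rewrite /H /X -powRrM; congr (_ `^ _); field.
  by rewrite ge0_ler_powR ?nnegrE ?(ltW lo) //; lra.
have cl k : `|k%:R - n%:R `^ (1 / 3)| <= 4 * H -> close_to_cbrt theta (4 : R) n k.
  by move=> /le_trans; apply; rewrite ler_pM2l.
have n0 : (0 < n)%N by rewrite -(ltr0n R); lra.
move: (n0); rewrite !muln_gt0 => /andP[/andP[a0 b0] m0].
exists n, a, b, m; split=> //; last 1 first.
- by split; apply: cl.
- by rewrite lo.
- split=> //; exists a, b, m; split=> //; exact: cl.
- by split; [apply: usA | apply: vsA].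
Qed.
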